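(* Let $\mathcal C$ be a braided monoidal category with a class $\mathcal Q$ of regular epimorphisms satisfying the standing assumptions in the context. There is a category $\mathcal M$, whose objects are the non-degenerate semigroups in $\mathcal C$ with multiplication in $\mathcal Q$, and whose morphisms are the dense multiplicative $\mathbb M$-morphisms. The composite $g\bullet f$ of composable morphisms $f\colon A\nrightarrow B$ and $g\colon B\nrightarrow C$ has components determined by $$(g\bullet f)_1.1g_1=g_1.f_11\colon ABC\to C,\qquad (g\bullet f)_2.g_21=g_2.1f_2\colon CBA\to C,$$ and the identity on an object $A$ is the $\mathbb M$-morphism $i\colon A\nrightarrow A$ with both components equal to the multiplication $m$. The monoidal unit $I$ equipped with the trivial multiplication is initial in the category $\mathcal M$.
   Context: Conventions. $\mathcal C$ is a braided monoidal category with monoidal unit $I$ and braiding $c$. The monoidal product is written by juxtaposition (of objects and of morphisms), associativity and unit isomorphisms are suppressed, $A^n$ is the $n$-fold monoidal power, $1$ denotes an identity morphism, and $g.f$ is the composite of $f\colon A\to B$ and $g\colon B\to C$. Standing assumptions on $\mathcal Q$. $\mathcal Q$ is a class of regular epimorphisms in $\mathcal C$ which contains the isomorphisms, is closed under composition and monoidal product, and is right-cancellative: if $s\colon A\to B$ and $t.s\colon A\to C$ are in $\mathcal Q$ then so is $t\colon B\to C$. Moreover each $q\in\mathcal Q$ is the coequalizer of some pair of morphisms, chosen so that this coequalizer is preserved by taking the monoidal product with any object. Semigroups. A semigroup is a pair $(A,m)$ with $m\colon A^2\to A$ satisfying $m.m1=m.1m$. It is non-degenerate if for all objects $X,Y$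 both maps $\mathcal C(X,YA)\to\mathcal C(XA,YA)$, $f\mapsto 1m.f1$, and $\mathcal C(X,AY)\to\mathcal C(AX,AY)$, $g\mapsto m1.1g$, are injective. $\mathbb M$-morphisms. For an object $A$ and a non-degenerate semigroup $B$, an $\mathbb M$-morphism $f\colon A\nrightarrow B$ is a pair of morphisms (components) $f_1\colon AB\to B$, $f_2\colon BA\to B$ with $m.1f_1=m.f_21\colon BAB\to B$. It is dense if $f_1,f_2\in\mathcal Q$. If $A$ is a semigroup, $f$ is multiplicative if $f_1.1f_1=f_1.m1\colon A^2B\to B$ and $f_2.f_21=f_2.1m\colon BA^2\to B$. *)

(* Defs.v *)
(* Plain Rocq; morphisms are compared with Leibniz equality. *)

Set Implicit Arguments.
Unset Strict Implicit.
Unset Printing Implicit Defensive.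

Declare Scope cat_scope.
Delimit Scope cat_scope with cat.
Open Scope cat_scope.

(** * Categories *)

(* A category structure with prescribed objects and morphisms, so that "there is
   a category whose objects are ... and whose morphisms are ..." can be stated
   without equations between types. *)
Record category_on (ob : Type) (hom : ob -> ob -> Type) : Type := CategoryOn {
  cat_id : forall A : ob, hom A A;
  cat_comp : forall A B C : ob, hom B C -> hom A B -> hom A C;
  cat_comp1f : forall (A B : ob) (f : hom A B), cat_comp (cat_id B) f = f;
  cat_compf1 : forall (A B : ob) (f : hom A B), cat_comp f (cat_id A) = f;
  cat_compA : forall (A B C D : ob) (h : hom C D) (g : hom B C) (f : hom A B),
    cat_comp h (cat_comp g f) = cat_comp (cat_comp h g) f
}.

Definition is_initial (ob : Type) (hom : ob -> ob -> Type)
    (_ : category_on hom) (U : ob) : Prop :=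
  forall A : ob, exists f : hom U A, forall g : hom U A, g = f.

Record category : Type := Category {
  ob :> Type;
  hom : ob -> ob -> Type;
  cat_struct : category_on hom
}.

Definition idm (C : category) (A : C) : hom A A := cat_id (cat_struct C) A.

Definition comp (C : category) (A B D : C) (g : hom B D) (f : hom A B) :
  hom A D := cat_comp (cat_struct C) g f.

Notation "g ∘ f" := (comp g f) (at level 40, left associativity) : cat_scope.

Definition is_iso (C : category) (A B : C) (f : hom A B) : Prop :=
  exists g : hom B A, g ∘ f = idm A /\ f ∘ g = idm B.

Definition is_coequalizer (C : category) (Z A B : C) (u v : hom Z A)
    (q : hom A B) : Prop :=
  q ∘ u = q ∘ v /\
  forall (D : C) (h : hom A D), h ∘ u = h ∘ v -> exists! k : hom B D, k ∘ q = h.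

Definition is_regular_epi (C : category) (A B : C) (q : hom A B) : Prop :=
  exists (Z : C) (u v : hom Z A), is_coequalizer u v q.

(** * Braided monoidal categories *)

Record monoidal_category : Type := MonoidalCategory {
  mc_cat :> category;
  tens : mc_cat -> mc_cat -> mc_cat;
  tensm : forall A A' B B' : mc_cat,
    hom A A' -> hom B B' -> hom (tens A B) (tens A' B');
  unit_ob : mc_cat;
  tensm_id : forall A B : mc_cat, tensm (idm A) (idm B) = idm (tens A B);
  tensm_comp : forall (A A' A'' B B' B'' : mc_cat)
      (f' : hom A' A'') (f : hom A A') (g' : hom B' B'') (g : hom B B'),
    tensm (f' ∘ f) (g' ∘ g) = tensm f' g' ∘ tensm f g;

  assoc : forall A B D : mc_cat, hom (tens (tens A B) D) (tens A (tens B D));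
  assoc_inv : forall A B D : mc_cat, hom (tens A (tens B D)) (tens (tens A B) D);
  assocK : forall A B D : mc_cat, assoc_inv A B D ∘ assoc A B D = idm _;
  assoc_invK : forall A B D : mc_cat, assoc A B D ∘ assoc_inv A B D = idm _;
  assoc_nat : forall (A A' B B' D D' : mc_cat)
      (f : hom A A') (g : hom B B') (h : hom D D'),
    assoc A' B' D' ∘ tensm (tensm f g) h = tensm f (tensm g h) ∘ assoc A B D;

  lunit : forall A : mc_cat, hom (tens unit_ob A) A;
  lunit_inv : forall A : mc_cat, hom A (tens unit_ob A);
  lunitK : forall A : mc_cat, lunit_inv A ∘ lunit A = idm _;
  lunit_invK : forall A : mc_cat, lunit A ∘ lunit_inv A = idm _;
  lunit_nat : forall (A A' : mc_cat) (f : hom A A'),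
    lunit A' ∘ tensm (idm unit_ob) f = f ∘ lunit A;

  runit : forall A : mc_cat, hom (tens A unit_ob) A;
  runit_inv : forall A : mc_cat, hom A (tens A unit_ob);
  runitK : forall A : mc_cat, runit_inv A ∘ runit A = idm _;
  runit_invK : forall A : mc_cat, runit A ∘ runit_inv A = idm _;
  runit_nat : forall (A A' : mc_cat) (f : hom A A'),
    runit A' ∘ tensm f (idm unit_ob) = f ∘ runit A;

  pentagon : forall A B D E : mc_cat,
    assoc A B (tens D E) ∘ assoc (tens A B) D E
    = tensm (idm A) (assoc B D E) ∘ assoc A (tens B D) E
      ∘ tensm (assoc A B D) (idm E);
  triangle : forall A B : mc_cat,
    tensm (idm A) (lunit B) ∘ assoc A unit_ob B = tensm (runit A) (idm B)
}.

Arguments unit_ob {_}.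
Arguments assoc {_} A B D.
Arguments assoc_inv {_} A B D.
Arguments lunit {_} A.
Arguments lunit_inv {_} A.
Arguments runit {_} A.
Arguments runit_inv {_} A.

Notation "A ⊗ B" := (tens A B) (at level 39, left associativity) : cat_scope.
Notation "f ⊠ g" := (tensm f g) (at level 39, left associativity) : cat_scope.
Notation "'𝟏'" := (idm _) : cat_scope.

Record braided_monoidal_category : Type := BraidedMonoidalCategory {
  bmc_monoidal :> monoidal_category;
  braid : forall A B : bmc_monoidal, hom (A ⊗ B) (B ⊗ A);
  braid_inv : forall A B : bmc_monoidal, hom (B ⊗ A) (A ⊗ B);
  braidK : forall A B : bmc_monoidal, braid_inv A B ∘ braid A B = 𝟏;
  braid_invK : forall A B : bmc_monoidal, braid A B ∘ braid_inv A B = 𝟏;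
  braid_nat : forall (A A' B B' : bmc_monoidal) (f : hom A A') (g : hom B B'),
    braid A' B' ∘ (f ⊠ g) = (g ⊠ f) ∘ braid A B;
  hexagon1 : forall A B D : bmc_monoidal,
    assoc B D A ∘ braid A (B ⊗ D) ∘ assoc A B D
    = (idm B ⊠ braid A D) ∘ assoc B A D ∘ (braid A B ⊠ idm D);
  hexagon2 : forall A B D : bmc_monoidal,
    assoc_inv D A B ∘ braid (A ⊗ B) D ∘ assoc_inv A B D
    = (braid A D ⊠ idm B) ∘ assoc_inv A D B ∘ (idm A ⊠ braid B D)
}.

(** * The class Q *)

Definition morphism_class (C : category) : Type :=
  forall A B : C, hom A B -> Prop.

Record standing_assumptions (C : braided_monoidal_category)
    (Q : morphism_class C) : Prop := StandingAssumptions {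
  Q_regular_epi : forall (A B : C) (q : hom A B), Q A B q -> is_regular_epi q;
  Q_iso : forall (A B : C) (f : hom A B), is_iso f -> Q A B f;
  Q_comp : forall (A B D : C) (t : hom B D) (s : hom A B),
    Q B D t -> Q A B s -> Q A D (t ∘ s);
  Q_tens : forall (A A' B B' : C) (s : hom A A') (t : hom B B'),
    Q A A' s -> Q B B' t -> Q (A ⊗ B) (A' ⊗ B') (s ⊠ t);
  Q_cancel : forall (A B D : C) (t : hom B D) (s : hom A B),
    Q A B s -> Q A D (t ∘ s) -> Q B D t;
  Q_coequalizer : forall (A B : C) (q : hom A B), Q A B q ->
    exists (Z : C) (u v : hom Z A),
      is_coequalizer u v q /\
      forall X : C,
        is_coequalizer (idm X ⊠ u) (idm X ⊠ v) (idm X ⊠ q) /\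
        is_coequalizer (u ⊠ idm X) (v ⊠ idm X) (q ⊠ idm X)
}.

(** * Semigroups *)

Record semigroup (C : monoidal_category) : Type := Semigroup {
  carrier :> C;
  mul : hom (carrier ⊗ carrier) carrier;
  mulA : mul ∘ (mul ⊠ 𝟏) = mul ∘ (𝟏 ⊠ mul) ∘ assoc carrier carrier carrier
}.

Arguments mul {C} A : rename.
Arguments mulA {C} A : rename.

Definition nondegenerate (C : monoidal_category) (A : semigroup C) : Prop :=
  (forall (X Y : C) (f f' : hom X (Y ⊗ A)),
     (idm Y ⊠ mul A) ∘ assoc Y A A ∘ (f ⊠ idm A)
     = (idm Y ⊠ mul A) ∘ assoc Y A A ∘ (f' ⊠ idm A) -> f = f') /\
  (forall (X Y : C) (g g' : hom X (A ⊗ Y)),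
     (mul A ⊠ idm Y) ∘ assoc_inv A A Y ∘ (idm A ⊠ g)
     = (mul A ⊠ idm Y) ∘ assoc_inv A A Y ∘ (idm A ⊠ g') -> g = g').

Record nd_semigroup (C : monoidal_category) : Type := NDSemigroup {
  nd_sg :> semigroup C;
  nd_nondegenerate : nondegenerate nd_sg
}.

(** * M-morphisms *)

Record Mmorphism (C : monoidal_category) (A : C) (B : nd_semigroup C) : Type :=
  MMorphism {
    mm1 : hom (A ⊗ B) B;
    mm2 : hom (B ⊗ A) B;
    mm_compat : mul B ∘ (idm B ⊠ mm1) ∘ assoc B A B = mul B ∘ (mm2 ⊠ idm B)
  }.

Definition dense (C : monoidal_category) (Q : morphism_class C)
    (A : C) (B : nd_semigroup C) (f : Mmorphism A B) : Prop :=
  Q _ _ (mm1 f) /\ Q _ _ (mm2 f).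

Definition multiplicative (C : monoidal_category) (A : semigroup C)
    (B : nd_semigroup C) (f : Mmorphism A B) : Prop :=
  mm1 f ∘ (idm A ⊠ mm1 f) ∘ assoc A A B = mm1 f ∘ (mul A ⊠ idm B) /\
  mm2 f ∘ (mm2 f ⊠ idm A) = mm2 f ∘ (idm B ⊠ mul A) ∘ assoc B A A.

(** * Objects and morphisms of the category M *)

Record M_ob (C : monoidal_category) (Q : morphism_class C) : Type := MOb {
  mo_sg :> nd_semigroup C;
  mo_mulQ : Q _ _ (mul mo_sg)
}.

Record M_hom (C : monoidal_category) (Q : morphism_class C) (A B : M_ob Q) :
    Type := MHom {
  mh_mor :> Mmorphism A B;
  mh_dense : dense Q mh_mor;
  mh_multiplicative : multiplicative mh_mor
}.

(** * The unit object as a semigroup *)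

Lemma compA (C : category) (A B D E : C)
    (h : hom D E) (g : hom B D) (f : hom A B) : h ∘ (g ∘ f) = h ∘ g ∘ f.
Proof. exact (cat_compA (cat_struct C) h g f). Qed.

Lemma comp1f (C : category) (A B : C) (f : hom A B) : 𝟏 ∘ f = f.
Proof. exact (cat_comp1f (cat_struct C) f). Qed.

Lemma compf1 (C : category) (A B : C) (f : hom A B) : f ∘ 𝟏 = f.
Proof. exact (cat_compf1 (cat_struct C) f). Qed.

Lemma tens1m_comp (C : monoidal_category) (X A B D : C) (g : hom B D) (f : hom A B) :
  idm X ⊠ (g ∘ f) = (idm X ⊠ g) ∘ (idm X ⊠ f).
Proof. now rewrite <- tensm_comp, comp1f. Qed.

Lemma tensm1_comp (C : monoidal_category) (X A B D : C) (g : hom B D) (f : hom A B) :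
  (g ∘ f) ⊠ idm X = (g ⊠ idm X) ∘ (f ⊠ idm X).
Proof. now rewrite <- tensm_comp, comp1f. Qed.

Lemma split_epi_cancel (C : category) (A B D : C)
    (e : hom A B) (s : hom B A) (f g : hom B D) :
  e ∘ s = 𝟏 -> f ∘ e = g ∘ e -> f = g.
Proof.
intros es E.
now rewrite <- (compf1 f), <- (compf1 g), <- es, !compA, E.
Qed.

Lemma tens_unit_inj (C : monoidal_category) (A B : C) (f g : hom A B) :
  idm unit_ob ⊠ f = idm unit_ob ⊠ g -> f = g.
Proof.
intros E.
apply (split_epi_cancel (lunit_invK A)).
now rewrite <- !lunit_nat, E.
Qed.

Lemma lunit_tens (C : monoidal_category) (A B : C) :
  lunit (A ⊗ B) ∘ assoc unit_ob A B = lunit A ⊠ idm B.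
Proof.
apply tens_unit_inj; rewrite tens1m_comp.
apply (split_epi_cancel (assoc_invK unit_ob (unit_ob ⊗ A) B)).
apply (@split_epi_cancel _ _ _ _ (assoc unit_ob unit_ob A ⊠ idm B)
         (assoc_inv unit_ob unit_ob A ⊠ idm B)).
  now rewrite <- tensm1_comp, assoc_invK, tensm_id.
rewrite <- (compA _ (idm unit_ob ⊠ assoc _ _ _)).
rewrite <- (compA (idm unit_ob ⊠ lunit _)), <- pentagon.
rewrite compA, triangle, <- tensm_id, <- assoc_nat.
rewrite <- (triangle unit_ob A), tensm1_comp, compA.
now rewrite assoc_nat.
Qed.

Lemma lunit_unit (C : monoidal_category) :
  lunit (unit_ob ⊗ unit_ob) = idm unit_ob ⊠ lunit (@unit_ob C).
Proof.
rewrite <- (comp1f (lunit _)), <- (comp1f (idm unit_ob ⊠ _)).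
now rewrite <- (lunitK unit_ob), <- !compA, lunit_nat.
Qed.

Lemma lunit_mulA (C : monoidal_category) :
  lunit (@unit_ob C) ∘ (lunit unit_ob ⊠ 𝟏)
  = lunit unit_ob ∘ (𝟏 ⊠ lunit unit_ob) ∘ assoc unit_ob unit_ob unit_ob.
Proof. now rewrite <- lunit_tens, lunit_unit, compA. Qed.

Definition unit_semigroup (C : monoidal_category) : semigroup C :=
  Semigroup (lunit_mulA C).

(* Main.v *)
From Stdlib Require Import ssreflect ProofIrrelevance IndefiniteDescription.
Require Import Defs.

Set Implicit Arguments.
Unset Strict Implicit.
Open Scope cat_scope.

(** Every morphism of [Q] is an epimorphism, and stays one after tensoring, so
    an identity between morphisms may be tested after precomposition with such a
    map.  The defining equation of a composite says exactly that
    [mm1 (g • f)], precomposed with the epimorphism [1 ⊠ mm1 g], is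
    [mm1 g . (mm1 f ⊠ 1)].  All the laws of the category then follow by
    precomposing with enough tensored components and rewriting; the point that
    needs an argument is that the composite exists.

    Existence rests on the following identity, called [composite_balance].
    For [f : A -/-> B] and [g : B -/-> D], with [g] multiplicative,
      [m . 1(g1 . f1 1) . g2 111 = m . g2 1 . 1 f2 1 . 111 g1] on [D B A B D].
    On the left, the compatibility of [g] turns [g1] into [g2];
    multiplicativity of [g] merges the two successive actions of [B] into a
    multiplication of [B]; against that multiplication the compatibility of [f]
    turns [f1] into [f2]; then the steps are undone.  Now [1 ⊠ g1] is the
    coequalizer of a pair [1 ⊠ u], [1 ⊠ v].  By non-degeneracy of [D], and since
    [g2] is epic, [g1 . f1 1] coequalizes this pair as soon as the left-hand side
    precomposed with [111u] and with [111v] agree; on the right-hand side these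
    are [111(g1 . u)] and [111(g1 . v)], which are equal.  This yields the first
    component.  Reading the identity from right to left yields the second
    component in the same way, from a pair coequalized by [g2], and the two
    components [h1], [h2] are compatible because [m . 1 h1] and [m . h2 1],
    precomposed with the epimorphism [g2 1 g1], are the two sides of the
    identity.

    By non-degeneracy an M-morphism is determined by its first component
    ([mm2_unique]), and it is multiplicative once its first component is
    ([multiplicative_mm1]).  So the unit laws, associativity and the uniqueness
    half of initiality concern first components only.  The left unit law
    additionally uses that first components are maps of right modules
    ([mm1_mul]).  The morphism from the unit object to [A] has the unit
    constraints as components; for any other [k], multiplicativity and
    naturality give [k1 . 1 k1 = lunit . 1 k1], and [1 k1] is epic. *)

(** * Epimorphisms and rewriting inside composites *)

Section Categories.
Variable C : category.

Definition epi (A B : C) (q : hom A B) : Prop :=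
  forall (D : C) (f g : hom B D), f ∘ q = g ∘ q -> f = g.

Lemma iso_epi (A B : C) (q : hom A B) : is_iso q -> epi q.
Proof. move=> [s [_ qs]] D f g; exact: split_epi_cancel qs. Qed.

Lemma coequalizer_epi (Z A B : C) (u v : hom Z A) (q : hom A B) :
  is_coequalizer u v q -> epi q.
Proof.
move=> [quv uq] D f g fg.
have hE : (f ∘ q) ∘ u = (f ∘ q) ∘ v by rewrite -!compA quv.
by case: (uq _ _ hE) => k [_ ku]; rewrite -(ku f) // -(ku g).
Qed.

Lemma comp_square (A B B' D : C) (a : hom B D) (b : hom A B)
    (c : hom B' D) (d : hom A B') :
  a ∘ b = c ∘ d -> forall (E : C) (x : hom D E), x ∘ a ∘ b = x ∘ c ∘ d.
Proof. by move=> E F x; rewrite -!compA E. Qed.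

Lemma comp_triangle (A B D : C) (a : hom B D) (b : hom A B) (c : hom A D) :
  a ∘ b = c -> forall (E : C) (x : hom D E), x ∘ a ∘ b = x ∘ c.
Proof. by move=> E F x; rewrite -!compA E. Qed.

End Categories.

(** * Morphisms acting at the head of a right-nested product *)

Section Tails.
Variable C : monoidal_category.
Implicit Types A B D E F X Y Z : C.

Lemma assoc_iso A B D : is_iso (assoc A B D).
Proof. by exists (assoc_inv A B D); split; [exact: assocK | exact: assoc_invK]. Qed.

Lemma assoc_inv_iso A B D : is_iso (assoc_inv A B D).
Proof. by exists (assoc A B D); split; [exact: assoc_invK | exact: assocK]. Qed.

Lemma tensm_swap A A' B B' (f : hom A A') (g : hom B B') :
  (f ⊠ idm B') ∘ (idm A ⊠ g) = (idm A' ⊠ g) ∘ (f ⊠ idm B).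
Proof. by rewrite -!tensm_comp !comp1f !compf1. Qed.

Lemma tens1m_square X A B B' D (a : hom B D) (b : hom A B) (c : hom B' D) (d : hom A B') :
  a ∘ b = c ∘ d ->
  (idm X ⊠ a) ∘ (idm X ⊠ b) = (idm X ⊠ c) ∘ (idm X ⊠ d).
Proof. by move=> E; rewrite -!tens1m_comp E. Qed.

Lemma tens_unitr_inj A B (f g : hom A B) :
  f ⊠ idm unit_ob = g ⊠ idm unit_ob -> f = g.
Proof.
move=> E; apply: (split_epi_cancel (runit_invK A)).
by rewrite -!runit_nat E.
Qed.

Lemma assoc_inv_nat A A' B B' D D' (f : hom A A') (g : hom B B') (h : hom D D') :
  assoc_inv A' B' D' ∘ (f ⊠ (g ⊠ h)) = ((f ⊠ g) ⊠ h) ∘ assoc_inv A B D.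
Proof.
apply: (iso_epi (assoc_iso A B D)).
rewrite -!compA assocK compf1 -assoc_nat compA assocK.
exact: comp1f.
Qed.

(** All iterated products are kept in the right-nested form
    [A1 ⊗ (A2 ⊗ (... ⊗ X))], so that associators never appear in the
    computations: [whisker f X] is [f] applied to the first two factors,
    and [idm A ⊠ _] moves past a factor.  The body is locked because rewriting
    with the functoriality of [idm A ⊠ _] would otherwise see the composite
    inside it. *)
Definition whisker A B D (f : hom (A ⊗ B) D) X : hom (A ⊗ (B ⊗ X)) (D ⊗ X) :=
  locked ((f ⊠ idm X) ∘ assoc_inv A B X).

Lemma whiskerE A B D (f : hom (A ⊗ B) D) X :
  whisker f X = (f ⊠ idm X) ∘ assoc_inv A B X.
Proof. by rewrite /whisker -lock. Qed.

(** The ternary analogue: an identity between morphisms out of [A ⊗ (B ⊗ D)] is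
    extended by a further factor [X] through [whisker3_inner] and
    [whisker3_outer]. *)
Definition whisker3 A B D E (t : hom (A ⊗ (B ⊗ D)) E) X :
    hom (A ⊗ (B ⊗ (D ⊗ X))) (E ⊗ X) :=
  whisker t X ∘ (idm A ⊠ assoc_inv B D X).

Lemma whisker_tail A B D (f : hom (A ⊗ B) D) X Y (h : hom X Y) :
  whisker f Y ∘ (idm A ⊠ (idm B ⊠ h)) = (idm D ⊠ h) ∘ whisker f X.
Proof.
rewrite !whiskerE -compA assoc_inv_nat compA tensm_id tensm_swap.
by rewrite compA.
Qed.

Lemma whisker_assoc A B D (f : hom (A ⊗ B) D) X :
  whisker f X ∘ assoc A B X = f ⊠ idm X.
Proof. by rewrite whiskerE -compA assocK compf1. Qed.

Lemma whisker3_inner A B D E F (p : hom (A ⊗ E) F) (f : hom (B ⊗ D) E) X :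
  whisker3 (p ∘ (idm A ⊠ f)) X = whisker p X ∘ (idm A ⊠ whisker f X).
Proof.
rewrite /whisker3 !whiskerE tensm1_comp tens1m_comp !compA.
by rewrite (comp_square (assoc_inv_nat _ _ _)).
Qed.

Lemma pentagon_inv A B D E :
  (assoc_inv A B D ⊠ idm E) ∘ assoc_inv A (B ⊗ D) E ∘ (idm A ⊠ assoc_inv B D E)
  = assoc_inv (A ⊗ B) D E ∘ assoc_inv A B (D ⊗ E).
Proof.
apply: (iso_epi (assoc_iso A B (D ⊗ E))).
rewrite -!compA assocK compf1.
apply: (iso_epi (assoc_iso (A ⊗ B) D E)).
rewrite assocK -!compA pentagon.
rewrite (compA (idm A ⊠ _)) (compA (idm A ⊠ _)) -tens1m_comp assocK tensm_id comp1f.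
by rewrite (compA (assoc_inv _ _ _)) assocK comp1f -tensm1_comp assocK tensm_id.
Qed.

Lemma whisker3_outer A B D E F (p : hom (D ⊗ E) F) (f : hom (A ⊗ B) D) X :
  whisker3 (p ∘ whisker f E) X = whisker p X ∘ whisker f (E ⊗ X).
Proof.
rewrite /whisker3 !whiskerE !tensm1_comp -!compA (compA (_ ⊠ idm X) _ (idm _ ⊠ _)) pentagon_inv.
by rewrite !compA (comp_square (eq_sym (assoc_inv_nat _ _ _))) tensm_id.
Qed.

(** Passes from the left-nested triple products, in which second components are
    composed, to right-nested ones. *)
Lemma whisker3_assoc A B D E (t : hom (A ⊗ (B ⊗ D)) E) X :
  ((t ∘ assoc A B D) ⊠ idm X) ∘ assoc_inv (A ⊗ B) D X
  = whisker3 t X ∘ assoc A B (D ⊗ X).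
Proof.
apply: (iso_epi (assoc_inv_iso A B (D ⊗ X))).
rewrite -!compA assoc_invK compf1 -pentagon_inv tensm1_comp !compA.
rewrite -(compA (t ⊠ idm X)) -tensm1_comp assoc_invK tensm_id compf1.
by rewrite /whisker3 whiskerE.
Qed.

End Tails.

(** * Non-degeneracy *)

Section Nondegenerate.
Variable C : monoidal_category.
Implicit Types A X : C.

Variable B : semigroup C.
Hypothesis ndB : nondegenerate B.

Lemma mul_whisker : mul B ∘ whisker (mul B) B = mul B ∘ (idm B ⊠ mul B).
Proof. by rewrite whiskerE compA mulA -compA assoc_invK compf1. Qed.

(** Non-degeneracy is stated for morphisms into [B ⊗ Y]; this is [Y] the unit
    object, with the unit constraint cancelled. *)
Lemma nondegenerate_r X (f f' : hom X B) :
  mul B ∘ (idm B ⊠ f) = mul B ∘ (idm B ⊠ f') -> f = f'.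
Proof.
move=> E; apply: tens_unitr_inj.
case: ndB => _ nd.
(* The unit constraint of [X] is put in front of [k ⊠ 1] so that its source is
   [X]; it is then carried through as an isomorphism. *)
have K : forall k : hom X B, (mul B ⊠ idm unit_ob) ∘ assoc_inv B B unit_ob ∘
   (idm B ⊠ ((k ⊠ idm unit_ob) ∘ runit_inv X))
   = ((mul B ∘ (idm B ⊠ k)) ⊠ idm unit_ob) ∘ assoc_inv B X unit_ob ∘ (idm B ⊠ runit_inv X).
  move=> k; rewrite tens1m_comp compA (comp_square (assoc_inv_nat _ _ _)).
  by rewrite -tensm1_comp.
have /nd {}E' : (mul B ⊠ idm unit_ob) ∘ assoc_inv B B unit_ob ∘
   (idm B ⊠ ((f ⊠ idm unit_ob) ∘ runit_inv X))
   = (mul B ⊠ idm unit_ob) ∘ assoc_inv B B unit_ob ∘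
   (idm B ⊠ ((f' ⊠ idm unit_ob) ∘ runit_inv X)) by rewrite !K E.
apply: (iso_epi (q := runit_inv X)) E'.
by exists (runit X); split; [exact: runit_invK | exact: runitK].
Qed.

Lemma nondegenerate_l X (f f' : hom X B) :
  mul B ∘ (f ⊠ idm B) = mul B ∘ (f' ⊠ idm B) -> f = f'.
Proof.
move=> E; apply: tens_unit_inj.
case: ndB => nd _.
have K : forall k : hom X B, (idm unit_ob ⊠ mul B) ∘ assoc unit_ob B B ∘
   (((idm unit_ob ⊠ k) ∘ lunit_inv X) ⊠ idm B)
   = (idm unit_ob ⊠ (mul B ∘ (k ⊠ idm B))) ∘ assoc unit_ob X B ∘ (lunit_inv X ⊠ idm B).
  move=> k; rewrite tensm1_comp compA (comp_square (assoc_nat _ _ _)).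
  by rewrite -tens1m_comp.
have /nd {}E' : (idm unit_ob ⊠ mul B) ∘ assoc unit_ob B B ∘
   (((idm unit_ob ⊠ f) ∘ lunit_inv X) ⊠ idm B)
   = (idm unit_ob ⊠ mul B) ∘ assoc unit_ob B B ∘
   (((idm unit_ob ⊠ f') ∘ lunit_inv X) ⊠ idm B) by rewrite !K E.
apply: (iso_epi (q := lunit_inv X)) E'.
by exists (lunit X); split; [exact: lunit_invK | exact: lunitK].
Qed.

Lemma nondegenerate_l3 A1 A2 A3 (t t' : hom (A1 ⊗ (A2 ⊗ A3)) B) :
  mul B ∘ whisker3 t B = mul B ∘ whisker3 t' B -> t = t'.
Proof.
rewrite /whisker3 !whiskerE !compA => E; apply: nondegenerate_l.
apply: (iso_epi (assoc_inv_iso _ _ _)).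
apply: (iso_epi (q := idm A1 ⊠ assoc_inv A2 A3 B)) E.
exists (idm A1 ⊠ assoc A2 A3 B).
by split; rewrite -tens1m_comp ?assocK ?assoc_invK tensm_id.
Qed.

End Nondegenerate.

(** * M-morphisms are determined by their first component *)

Section Mmorphisms.
Variable C : monoidal_category.

Lemma mm_compat_whisker (A : C) (B : nd_semigroup C) (f : Mmorphism A B) :
  mul B ∘ whisker (mm2 f) B = mul B ∘ (idm B ⊠ mm1 f).
Proof. by rewrite whiskerE compA -mm_compat -compA assoc_invK compf1. Qed.

Lemma mm_compat_whisker_tail (A : C) (B : nd_semigroup C) (f : Mmorphism A B) X :
  whisker (mul B) X ∘ whisker (mm2 f) (B ⊗ X)
  = whisker (mul B) X ∘ (idm B ⊠ whisker (mm1 f) X).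
Proof. by rewrite -whisker3_outer mm_compat_whisker whisker3_inner. Qed.

(** The first component commutes with the right multiplication of [B]: after
    multiplying by [B] on the left, compatibility replaces [mm1 f] by [mm2 f],
    which acts on a factor that the right multiplication does not touch. *)
Lemma mm1_mul (A : C) (B : nd_semigroup C) (f : Mmorphism A B) :
  mm1 f ∘ (idm A ⊠ mul B) = mul B ∘ whisker (mm1 f) B.
Proof.
apply: (nondegenerate_r (nd_nondegenerate B)).
rewrite !tens1m_comp !compA -mm_compat_whisker.
rewrite (comp_square (whisker_tail _ _)) -mul_whisker.
by rewrite (comp_square (mm_compat_whisker_tail f B)).
Qed.

Lemma mm2_unique (A : C) (B : nd_semigroup C) (f f' : Mmorphism A B) :
  mm1 f = mm1 f' -> mm2 f = mm2 f'.
Proof.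
move=> E; apply: (nondegenerate_l (nd_nondegenerate B)).
by rewrite -!mm_compat E.
Qed.

Lemma multiplicative1P (A : semigroup C) (B : C) (f1 : hom (A ⊗ B) B) :
  f1 ∘ (idm A ⊠ f1) ∘ assoc A A B = f1 ∘ (mul A ⊠ idm B)
  <-> f1 ∘ (idm A ⊠ f1) = f1 ∘ whisker (mul A) B.
Proof.
split=> E; last by rewrite E -compA whisker_assoc.
by rewrite whiskerE compA -E -compA assoc_invK compf1.
Qed.

Lemma multiplicative2P (A : semigroup C) (B : C) (f2 : hom (B ⊗ A) B) :
  f2 ∘ (f2 ⊠ idm A) = f2 ∘ (idm B ⊠ mul A) ∘ assoc B A A
  <-> f2 ∘ whisker f2 A = f2 ∘ (idm B ⊠ mul A).
Proof.
split=> E; last by rewrite -E -compA whisker_assoc.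
by rewrite whiskerE compA E -compA assoc_invK compf1.
Qed.

(** Multiplying the second condition by [B] on the right turns each [mm2 f] into
    an [mm1 f], hence reduces it to the first condition. *)
Lemma multiplicative_mm1 (A : semigroup C) (B : nd_semigroup C) (f : Mmorphism A B) :
  mm1 f ∘ (idm A ⊠ mm1 f) = mm1 f ∘ whisker (mul A) B -> multiplicative f.
Proof.
move=> E; split; first exact/multiplicative1P.
apply/multiplicative2P.
apply: (nondegenerate_l3 (nd_nondegenerate B)).
rewrite whisker3_outer whisker3_inner !compA !mm_compat_whisker.
rewrite (comp_square (eq_sym (whisker_tail _ _))) mm_compat_whisker.
by rewrite -!(compA (mul B)) -!tens1m_comp E.
Qed.

Lemma Mmorphism_eq (A : C) (B : nd_semigroup C) (f f' : Mmorphism A B) :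
  mm1 f = mm1 f' -> f = f'.
Proof.
move=> E1; have E2 := mm2_unique E1; move: E2 E1; case: f => f1 f2 c; case: f' => f1' f2' c' /= E2 E1.
by move: c c'; rewrite E1 E2 => c c'; rewrite (proof_irrelevance _ c c').
Qed.

Lemma M_hom_eq (Q : morphism_class C) (A B : M_ob Q) (f f' : M_hom A B) :
  mm1 f = mm1 f' -> f = f'.
Proof.
case: f => f d m; case: f' => f' d' m' /= /Mmorphism_eq E.
move: d m d' m'; rewrite E => d m d' m'.
by rewrite (proof_irrelevance _ d d') (proof_irrelevance _ m m').
Qed.

End Mmorphisms.

(** * Composition of M-morphisms *)

Section Composition.
Variables (C : braided_monoidal_category) (Q : morphism_class C).
Hypothesis hQ : standing_assumptions Q.

Lemma Q_epi (A B : C) (q : hom A B) : Q q -> epi q.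
Proof. by move=> /(Q_regular_epi hQ) [Z [u [v /coequalizer_epi]]]. Qed.

Lemma Q_id (A : C) : Q (idm A).
Proof. by apply: (Q_iso hQ); exists (idm A); rewrite comp1f. Qed.

Lemma Q_tens1m (X A B : C) (q : hom A B) : Q q -> Q (idm X ⊠ q).
Proof. by move=> qQ; apply: (Q_tens hQ) => //; exact: Q_id. Qed.

Lemma Q_tensm1 (X A B : C) (q : hom A B) : Q q -> Q (q ⊠ idm X).
Proof. by move=> qQ; apply: (Q_tens hQ) => //; exact: Q_id. Qed.

Lemma Q_whisker (A B D : C) (q : hom (A ⊗ B) D) X : Q q -> Q (whisker q X).
Proof.
move=> qQ; rewrite whiskerE; apply: (Q_comp hQ); first exact: Q_tensm1.
exact/(Q_iso hQ)/assoc_inv_iso.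
Qed.

Section Composite.
Variables (A : C) (B D : nd_semigroup C) (f : Mmorphism A B) (g : Mmorphism B D).
Hypotheses (g_dense : dense Q g) (g_mult : multiplicative g).

(** The identity that produces the composite: it exchanges [mm1 f] followed by
    [mm1 g] for [mm2 f] followed by [mm2 g].  No direct exchange is possible,
    since compatibility of [f] needs a multiplication by [B] on the left; the
    factor acted on by [mm2 g] supplies it, as [g] is multiplicative. *)
Lemma composite_balance :
  mul D ∘ (idm D ⊠ (mm1 g ∘ whisker (mm1 f) D)) ∘ whisker (mm2 g) (A ⊗ (B ⊗ D))
  = mul D ∘ whisker (mm2 g) D ∘ (idm D ⊠ whisker (mm2 f) D)
    ∘ (idm D ⊠ (idm B ⊠ (idm A ⊠ mm1 g))).
Proof.
(* [mm2 g] is an action of [B] on [D], in the presence of a tail [X]. *)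
have act X : whisker (mm2 g) X ∘ whisker (mm2 g) (B ⊗ X)
    = whisker (mm2 g) X ∘ (idm D ⊠ whisker (mul B) X).
  case: g_mult => _ /multiplicative2P E.
  by rewrite -whisker3_outer E whisker3_inner.
rewrite tens1m_comp !compA -(comp_square (whisker_tail _ _)).
rewrite -mm_compat_whisker (comp_square (act _)).
rewrite (comp_square (tens1m_square _ (eq_sym (mm_compat_whisker_tail f D)))).
rewrite -(comp_square (act _)) mm_compat_whisker.
rewrite -(comp_square (whisker_tail _ _)).
by rewrite -(comp_square (tens1m_square _ (whisker_tail _ _))) mm_compat_whisker.
Qed.

(** [mm1 g . (mm1 f ⊠ 1)] factors through the coequalizer [1 ⊠ mm1 g]: on the
    right-hand side of [composite_balance] the last morphism applied to the
    parallel pair is [mm1 g] itself. *)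
Lemma composite1_exists :
  exists h1 : hom (A ⊗ D) D,
    h1 ∘ (idm A ⊠ mm1 g) = mm1 g ∘ whisker (mm1 f) D.
Proof.
case: g_dense => g1Q g2Q.
case: (Q_coequalizer hQ g1Q) => Z [u [v [[guv _] /(_ A) [[_ co] _]]]].
case: (co _ (mm1 g ∘ whisker (mm1 f) D)) => [|h1 [h1E _]]; last by exists h1.
apply: (nondegenerate_r (nd_nondegenerate D)).
apply: (Q_epi (Q_whisker _ g2Q)).
have slide (w : hom Z (B ⊗ D)) :
    mul D ∘ (idm D ⊠ (mm1 g ∘ whisker (mm1 f) D ∘ (idm A ⊠ w)))
      ∘ whisker (mm2 g) (A ⊗ Z)
    = mul D ∘ whisker (mm2 g) D ∘ (idm D ⊠ whisker (mm2 f) D)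
      ∘ (idm D ⊠ (idm B ⊠ (idm A ⊠ (mm1 g ∘ w)))).
  rewrite (tens1m_comp _ _ (idm A ⊠ w)) !compA.
  rewrite -(comp_square (whisker_tail _ _)) composite_balance.
  by rewrite !tens1m_comp !compA.
by rewrite !slide guv.
Qed.

(** The mirror image, with [composite_balance] read from right to left: on its
    left-hand side the parallel pair meets [mm2 g]. *)
Lemma composite2_exists :
  exists h2 : hom (D ⊗ A) D,
    h2 ∘ (mm2 g ⊠ idm A) = mm2 g ∘ (idm D ⊠ mm2 f) ∘ assoc D B A.
Proof.
case: g_dense => g1Q g2Q.
case: (Q_coequalizer hQ g2Q) => Z [u [v [[guv _] /(_ A) [_ [_ co]]]]].
case: (co _ (mm2 g ∘ (idm D ⊠ mm2 f) ∘ assoc D B A)) => [|h2 [h2E _]]; last by exists h2.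
apply: (nondegenerate_l (nd_nondegenerate D)).
apply: (iso_epi (assoc_inv_iso Z A D)).
apply: (Q_epi (Q_tens1m Z (Q_tens1m A g1Q))).
have slide (w : hom Z (D ⊗ B)) :
    mul D ∘ ((mm2 g ∘ (idm D ⊠ mm2 f) ∘ assoc D B A ∘ (w ⊠ idm A)) ⊠ idm D)
      ∘ assoc_inv Z A D ∘ (idm Z ⊠ (idm A ⊠ mm1 g))
    = mul D ∘ (idm D ⊠ (mm1 g ∘ whisker (mm1 f) D))
      ∘ ((mm2 g ∘ w) ⊠ idm (A ⊗ (B ⊗ D))).
  rewrite (tensm1_comp D (_ ∘ _ ∘ _)) !compA.
  rewrite -(comp_square (assoc_inv_nat _ _ _)) tensm_id.
  rewrite (comp_square (tensm_swap w _)).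
  have -> : mul D ∘ ((mm2 g ∘ (idm D ⊠ mm2 f) ∘ assoc D B A) ⊠ idm D)
      ∘ assoc_inv (D ⊗ B) A D
      = mul D ∘ whisker (mm2 g) D ∘ (idm D ⊠ whisker (mm2 f) D)
        ∘ assoc D B (A ⊗ D).
    by rewrite -(compA (mul D)) whisker3_assoc whisker3_inner !compA.
  rewrite -{1}(tensm_id D B) (comp_square (assoc_nat _ _ _)) -composite_balance.
  by rewrite (comp_triangle (whisker_assoc _ _)) tensm1_comp !compA.
by rewrite !slide guv.
Qed.

Definition is_composite (h : Mmorphism A D) : Prop :=
  mm1 h ∘ (idm A ⊠ mm1 g) = mm1 g ∘ whisker (mm1 f) D /\
  mm2 h ∘ (mm2 g ⊠ idm A) = mm2 g ∘ (idm D ⊠ mm2 f) ∘ assoc D B A.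

Lemma composite_exists : exists h : Mmorphism A D, is_composite h.
Proof.
case: composite1_exists => h1 h1E; case: composite2_exists => h2 h2E.
have h2T X : whisker h2 X ∘ whisker (mm2 g) (A ⊗ X)
    = whisker (mm2 g) X ∘ (idm D ⊠ whisker (mm2 f) X).
  rewrite -whisker3_outer -whisker3_inner; congr (whisker3 _ X).
  by rewrite whiskerE compA h2E -compA assoc_invK compf1.
(* Precomposed with [g2 1 g1], both sides become those of
   [composite_balance]. *)
have compat : mul D ∘ (idm D ⊠ h1) ∘ assoc D A D = mul D ∘ (h2 ⊠ idm D).
  rewrite -whisker_assoc compA; congr (_ ∘ _).
  case: g_dense => g1Q g2Q.
  apply: (Q_epi (Q_whisker _ g2Q)).
  apply: (Q_epi (Q_tens1m _ (Q_tens1m _ (Q_tens1m _ g1Q)))).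
  rewrite (comp_square (h2T _)) -composite_balance.
  rewrite (comp_square (whisker_tail _ _)) -h1E.
  by rewrite tens1m_comp !compA.
by exists (MMorphism compat).
Qed.

(** Right cancellation in [Q], applied to the equations that define [h]. *)
Lemma composite_dense (h : Mmorphism A D) :
  is_composite h -> dense Q f -> dense Q h.
Proof.
case: g_dense => g1Q g2Q [h1E h2E] [f1Q f2Q]; split.
  apply: (Q_cancel hQ (Q_tens1m A g1Q)).
  by rewrite h1E; apply: (Q_comp hQ) => //; exact: Q_whisker.
apply: (Q_cancel hQ (Q_tensm1 A g2Q)); rewrite h2E.
apply: (Q_comp hQ); last exact/(Q_iso hQ)/assoc_iso.
by apply: (Q_comp hQ) => //; exact: Q_tens1m.
Qed.

End Composite.

Lemma composite_multiplicative (A : semigroup C) (B D : nd_semigroup C)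
    (f : Mmorphism A B) (g : Mmorphism B D) (h : Mmorphism A D) :
  dense Q g -> is_composite f g h -> multiplicative f -> multiplicative h.
Proof.
move=> [g1Q _] [h1E _] [/multiplicative1P f1M _].
apply: multiplicative_mm1.
apply: (Q_epi (Q_tens1m A (Q_tens1m A g1Q))).
have fT : whisker (mm1 f) D ∘ (idm A ⊠ whisker (mm1 f) D)
    = whisker (mm1 f) D ∘ whisker (mul A) (B ⊗ D).
  by rewrite -whisker3_inner f1M whisker3_outer.
rewrite (comp_square (tens1m_square A h1E)) h1E.
by rewrite (comp_square fT) -h1E (comp_square (whisker_tail _ _)).
Qed.

(** Both threefold composites, precomposed with [1 ⊠ mm1 k] and
    [1 ⊠ (mm1 g ⊠ 1)], become [k1 . g1 1 . f1 11]. *)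
Lemma composite1_assoc (A : C) (B D E : nd_semigroup C) (f : Mmorphism A B)
    (g : Mmorphism B D) (k : Mmorphism D E) (gf : Mmorphism A D)
    (kg : Mmorphism B E) (kgf kgf' : Mmorphism A E) :
  dense Q g -> dense Q k ->
  is_composite f g gf -> is_composite g k kg ->
  is_composite gf k kgf -> is_composite f kg kgf' ->
  mm1 kgf = mm1 kgf'.
Proof.
move=> [g1Q _] [k1Q _] [gfE _] [kgE _] [kgfE _] [kgfE' _].
apply: (Q_epi (Q_tens1m A k1Q)).
apply: (Q_epi (Q_tens1m A (Q_whisker E g1Q))).
have gfT : whisker (mm1 gf) E ∘ (idm A ⊠ whisker (mm1 g) E)
    = whisker (mm1 g) E ∘ whisker (mm1 f) (D ⊗ E).
  by rewrite -whisker3_inner gfE whisker3_outer.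
rewrite kgfE (comp_square gfT) -kgE -(comp_square (whisker_tail _ _)) -kgfE'.
by rewrite -!(compA (mm1 kgf')) -!tens1m_comp kgE.
Qed.

(** The equation defining [f • i] is the multiplicativity of [f]. *)
Lemma composite1_idr (A B : nd_semigroup C) (i : Mmorphism A A)
    (f h : Mmorphism A B) :
  dense Q f -> multiplicative f -> mm1 i = mul A -> is_composite i f h ->
  mm1 h = mm1 f.
Proof.
move=> [f1Q _] [/multiplicative1P f1M _] iE [hE _].
by apply: (Q_epi (Q_tens1m A f1Q)); rewrite hE iE f1M.
Qed.

(** The equation defining [i • f] is the right linearity of [f]. *)
Lemma composite1_idl (A : C) (B : nd_semigroup C) (i : Mmorphism B B)
    (f h : Mmorphism A B) :
  Q (mul B) -> mm1 i = mul B -> is_composite f i h -> mm1 h = mm1 f.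
Proof.
move=> mQ iE [hE _].
by apply: (Q_epi (Q_tens1m A mQ)); move: hE; rewrite iE (mm1_mul f).
Qed.

(** * The category *)

Definition id_Mmorphism (A : nd_semigroup C) : Mmorphism A A :=
  MMorphism (eq_sym (mulA A)).

Lemma id_multiplicative (A : nd_semigroup C) : multiplicative (id_Mmorphism A).
Proof. by apply: multiplicative_mm1; rewrite /= mul_whisker. Qed.

Definition id_M (A : M_ob Q) : M_hom A A :=
  MHom (conj (mo_mulQ A) (mo_mulQ A) : dense Q (id_Mmorphism A))
       (id_multiplicative A).

Lemma comp_M_exists (A B D : M_ob Q) (g : M_hom B D) (f : M_hom A B) :
  exists h : M_hom A D, is_composite f g h.
Proof.
have [h hE] := composite_exists f (mh_dense g) (mh_multiplicative g).
exists (MHom (composite_dense (mh_dense g) hE (mh_dense f))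
   (composite_multiplicative (mh_dense g) hE (mh_multiplicative f))).
exact: hE.
Qed.

(** The composite is unique but comes from an existential statement about
    coequalizers, so a description principle is needed to make it a function. *)
Definition comp_M (A B D : M_ob Q) (g : M_hom B D) (f : M_hom A B) : M_hom A D :=
  proj1_sig (constructive_indefinite_description _ (comp_M_exists g f)).

Lemma comp_ME (A B D : M_ob Q) (g : M_hom B D) (f : M_hom A B) :
  is_composite f g (comp_M g f).
Proof. by rewrite /comp_M; case: constructive_indefinite_description. Qed.

Lemma comp_M1f (A B : M_ob Q) (f : M_hom A B) : comp_M (id_M B) f = f.
Proof.
apply: M_hom_eq.
exact: (composite1_idl (mo_mulQ B) _ (comp_ME (id_M B) f)).
Qed.

Lemma comp_Mf1 (A B : M_ob Q) (f : M_hom A B) : comp_M f (id_M A) = f.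
Proof.
apply: M_hom_eq.
exact: (composite1_idr (mh_dense f) (mh_multiplicative f) _ (comp_ME f (id_M A))).
Qed.

Lemma comp_MA (A B D E : M_ob Q) (k : M_hom D E) (g : M_hom B D) (f : M_hom A B) :
  comp_M k (comp_M g f) = comp_M (comp_M k g) f.
Proof.
apply: M_hom_eq.
exact: (composite1_assoc (mh_dense g) (mh_dense k) (comp_ME _ _) (comp_ME _ _)
          (comp_ME _ _) (comp_ME _ _)).
Qed.

Definition category_M : category_on (@M_hom C Q) :=
  CategoryOn comp_M1f comp_Mf1 comp_MA.

(** * The unit object is initial *)

Lemma lunit_iso (A : C) : is_iso (lunit A).
Proof. by exists (lunit_inv A); split; [exact: lunitK | exact: lunit_invK]. Qed.

Lemma runit_iso (A : C) : is_iso (runit A).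
Proof. by exists (runit_inv A); split; [exact: runitK | exact: runit_invK]. Qed.

(** Up to unit constraints, the two maps in the definition of non-degeneracy are
    [_ ⊠ 1] and [1 ⊠ _] on the unit object, which are injective. *)
Lemma unit_nondegenerate : nondegenerate (unit_semigroup C).
Proof.
split=> X Y f f' /=.
  rewrite triangle -!tensm1_comp => /tens_unitr_inj E.
  by rewrite -(comp1f f) -(comp1f f') -(runitK Y) -!compA E.
rewrite -lunit_tens -!(compA (lunit _) (assoc _ _ _)) assoc_invK compf1 !lunit_nat.
exact: (iso_epi (lunit_iso X)).
Qed.

Definition unit_M : M_ob Q :=
  @MOb _ Q (NDSemigroup unit_nondegenerate) (Q_iso hQ (lunit_iso unit_ob)).

Lemma initial_compat (A : nd_semigroup C) :
  mul A ∘ (idm A ⊠ lunit A) ∘ assoc A unit_ob A = mul A ∘ (runit A ⊠ idm A).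
Proof. by rewrite -compA triangle. Qed.

Definition initial_Mmorphism (A : nd_semigroup C) : Mmorphism unit_ob A :=
  MMorphism (initial_compat A).

Lemma whisker_lunit (A : C) : whisker (lunit unit_ob) A = lunit (unit_ob ⊗ A).
Proof. by rewrite whiskerE -lunit_tens -compA assoc_invK compf1. Qed.

Lemma initial_multiplicative (A : nd_semigroup C) :
  multiplicative (A := unit_semigroup C) (initial_Mmorphism A).
Proof. by apply: multiplicative_mm1; rewrite /= whisker_lunit lunit_nat. Qed.

Lemma initial_dense (A : nd_semigroup C) : dense Q (initial_Mmorphism A).
Proof. by split; apply: (Q_iso hQ); [exact: lunit_iso | exact: runit_iso]. Qed.

Lemma unit_M_initial : is_initial category_M unit_M.
Proof.
move=> A.
exists (@MHom _ Q unit_M A _ (initial_dense A) (initial_multiplicative A)) => g.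
apply: M_hom_eq => /=.
case: (mh_multiplicative g) => /multiplicative1P gM _.
case: (mh_dense g) => g1Q _.
apply: (Q_epi (Q_tens1m unit_ob g1Q)).
by rewrite lunit_nat gM /= whisker_lunit.
Qed.

End Composition.

Theorem proposition3p5 (C : braided_monoidal_category) (Q : morphism_class C)
    (hQ : standing_assumptions Q) :
  exists M : category_on (@M_hom C Q),
    (forall (A B D : M_ob Q) (f : M_hom A B) (g : M_hom B D),
       (forall h : hom (A ⊗ D) D,
          h ∘ (idm A ⊠ mm1 g) ∘ assoc A B D = mm1 g ∘ (mm1 f ⊠ idm D)
          <-> h = mm1 (cat_comp M g f)) /\
       (forall h : hom (D ⊗ A) D,
          h ∘ (mm2 g ⊠ idm A) = mm2 g ∘ (idm D ⊠ mm2 f) ∘ assoc D B A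
          <-> h = mm2 (cat_comp M g f))) /\
    (forall A : M_ob Q,
       mm1 (cat_id M A) = mul A /\ mm2 (cat_id M A) = mul A) /\
    (exists U : M_ob Q,
       nd_sg U = unit_semigroup C /\ is_initial M U).
Proof.
exists (category_M hQ); split; last first.
  split=> //; exists (unit_M hQ); split=> //; exact: unit_M_initial.
move=> A B D f g /=.
case: (mh_dense g) (comp_ME hQ g f) => g1Q g2Q [c1E c2E].
split=> h; split=> [hE | ->].
- apply: (Q_epi hQ (Q_tens1m hQ A g1Q)).
  apply: (iso_epi (assoc_iso A B D)).
  by rewrite hE c1E -compA whisker_assoc.
- by rewrite c1E -compA whisker_assoc.
- by apply: (Q_epi hQ (Q_tensm1 hQ A g2Q)); rewrite hE c2E.
- exact: c2E.
Qed.
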